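(* Let $SG_2$ be the singular braid group on two strands, $SP_2\subset SG_2$ the singular pure braid group, and put $a_{12}=\sigma_1^2$, $b_{12}=\sigma_1\tau_1$. Then: 1) $a_{12},b_{12}$ generate $SP_2$ and $SP_2=\langle a_{12},b_{12}\mid a_{12}b_{12}=b_{12}a_{12}\rangle\cong\mathbb{Z}\times\mathbb{Z}$; 2) $SP_2$ is normal in $SG_2$, and the conjugation action of $SG_2$ on $SP_2$ is given by $$a_{12}^{\sigma_1}=a_{12},\quad b_{12}^{\sigma_1}=b_{12},\quad a_{12}^{\tau_1}=a_{12},\quad b_{12}^{\tau_1}=b_{12}.$$
   Context: The singular braid group on two strands is $SG_2=\langle \sigma_1,\tau_1\mid \sigma_1\tau_1=\tau_1\sigma_1\rangle$. The singular pure braid group $SP_2$ is the kernel of the homomorphism $\pi:SG_2\to S_2$ onto the symmetric group with $\pi(\sigma_1)=\pi(\tau_1)=(1,2)$. Notation: $x^g=g^{-1}xg$. Writing a group as $\langle X\mid R\rangle$ for given elements $X$ of it means that these elements generate it and that $R$ is a set of defining relations. *)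

(* Defs.v *)
From HB Require Import structures.
From mathcomp Require Import all_boot all_order ssralg ssrint perm.
From mathcomp Require Import boolp.

Set Implicit Arguments.
Unset Strict Implicit.
Unset Printing Implicit Defensive.

Local Open Scope group_scope.

(* A letter (i, false) stands for the generator x_i, (i, true) for x_i^-1. *)
Definition word (n : nat) := seq ('I_n * bool).

Definition gen (n : nat) (i : 'I_n) : word n := [:: (i, false)].

Definition winv (n : nat) (w : word n) : word n :=
  rev [seq (l.1, ~~ l.2) | l <- w].

Definition eval (n : nat) (G : groupType) (t : n.-tuple G) (w : word n) : G :=
  \prod_(l <- w) (if l.2 then (tnth t l.1)^-1 else tnth t l.1).

(* The congruence on words generated by free cancellation and the relations
   u = v for (u, v) in R: its classes form the group <x_0, ..., x_{n-1} | R>. *)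
Inductive pres_eq (n : nat) (R : seq (word n * word n)) :
    word n -> word n -> Prop :=
| pres_refl u : pres_eq R u u
| pres_sym u v : pres_eq R u v -> pres_eq R v u
| pres_trans u v w : pres_eq R u v -> pres_eq R v w -> pres_eq R u w
| pres_cat u u' v v' :
    pres_eq R u u' -> pres_eq R v v' -> pres_eq R (u ++ v) (u' ++ v')
| pres_cancel i b : pres_eq R [:: (i, b); (i, ~~ b)] [::]
| pres_rel u v : (u, v) \in R -> pres_eq R u v.

Definition pres_eqb (n : nat) (R : seq (word n * word n)) : rel (word n) :=
  fun u v => `[< pres_eq R u v >].

Lemma pres_eqb_equiv n R : equiv_class_of (@pres_eqb n R).
Proof.
split=> [u|u v|v u w].
- by apply/asboolP; apply: pres_refl.
- by apply/asboolP/asboolP; apply: pres_sym.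
- by move=> /asboolP uv /asboolP vw; apply/asboolP; apply: pres_trans vw.
Qed.

Canonical pres_equiv (n : nat) (R : seq (word n * word n)) :=
  EquivRelPack (pres_eqb_equiv R).

Definition pgroup (n : nat) (R : seq (word n * word n)) :=
  {eq_quot (pres_equiv R)}%qT.

HB.instance Definition _ n (R : seq (word n * word n)) :=
  Choice.copy (pgroup R) {eq_quot (pres_equiv R)}%qT.

Definition pclass (n : nat) (R : seq (word n * word n)) (w : word n) :
  pgroup R := \pi_({eq_quot (pres_equiv R)}%qT)%qT w.

Definition pword (n : nat) (R : seq (word n * word n)) (p : pgroup R) : word n :=
  repr (p : {eq_quot (pres_equiv R)}%qT).

Lemma pgroup_eq n (R : seq (word n * word n)) u v :
  pres_eq R u v <-> pclass R u = pclass R v.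
Proof.
by split=> [uv|/eqmodP/asboolP//]; apply/eqmodP/asboolP.
Qed.

Lemma pgroup_pword n (R : seq (word n * word n)) u :
  pres_eq R (pword (pclass R u)) u.
Proof. by apply/pgroup_eq; rewrite /pclass /pword reprK. Qed.

Lemma pwordK n (R : seq (word n * word n)) (p : pgroup R) : pclass R (pword p) = p.
Proof. exact: reprK. Qed.

Section PGroup.
Context (n : nat) (R : seq (word n * word n)).

Let pmul (p q : pgroup R) : pgroup R := pclass R (pword p ++ pword q).
Let pinv (p : pgroup R) : pgroup R := pclass R (winv (pword p)).
Let pone : pgroup R := pclass R [::].

Let pmulA : associative pmul.
Proof.
move=> p q r; apply/pgroup_eq; apply: (pres_trans (v := pword p ++ pword q ++ pword r)).
  by apply: pres_cat (pgroup_pword _ _); apply: pres_refl.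
rewrite catA; apply: pres_cat (pres_refl _ _).
exact: pres_sym (pgroup_pword _ _).
Qed.

Let pmul1 : left_id pone pmul.
Proof.
move=> p; rewrite -[RHS]pwordK; apply/pgroup_eq; rewrite -[X in pres_eq _ _ X]cat0s.
exact: pres_cat (pgroup_pword _ _) (pres_refl _ _).
Qed.

Let p1mul : right_id pone pmul.
Proof.
move=> p; rewrite -[RHS]pwordK; apply/pgroup_eq; rewrite -[X in pres_eq _ _ X]cats0.
exact: pres_cat (pres_refl _ _) (pgroup_pword _ _).
Qed.

Lemma winvK : involutive (@winv n).
Proof.
move=> w; rewrite /winv map_rev revK -map_comp -[RHS]map_id.
by apply: eq_map => -[i b] /=; rewrite negbK.
Qed.

Lemma pres_mulwV (w : word n) : pres_eq R (w ++ winv w) [::].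
Proof.
elim: w => [|[i b] w IHw]; first exact: pres_refl.
rewrite /winv map_cons rev_cons -cats1 cat_cons catA -cat1s.
apply: pres_trans (pres_cancel R i b); rewrite -[X in pres_eq _ _ X]/([:: (i, b)] ++ [::] ++ [:: (i, ~~ b)]).
by apply: pres_cat (pres_refl _ _) _; apply: pres_cat IHw (pres_refl _ _).
Qed.

Let pmulV : right_inverse pone pinv pmul.
Proof.
move=> p; apply/pgroup_eq; apply: pres_trans (pres_mulwV (pword p)).
exact: pres_cat (pres_refl _ _) (pgroup_pword _ _).
Qed.

Let pVmul : left_inverse pone pinv pmul.
Proof.
move=> p; apply/pgroup_eq; apply: pres_trans (pres_mulwV (winv (pword p))).
rewrite winvK; exact: pres_cat (pgroup_pword _ _) (pres_refl _ _).
Qed.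

HB.instance Definition _ :=
  isGroup.Build (pgroup R) pmulA pmul1 p1mul pVmul pmulV.

End PGroup.

Definition pgen (n : nat) (R : seq (word n * word n)) (i : 'I_n) : pgroup R :=
  pclass R (gen i).

(* The homomorphism x_i |-> t_i; it does not depend on the representative (and
   is a homomorphism) when t satisfies R, see pliftE and plift_morph. *)
Definition plift (n : nat) (R : seq (word n * word n)) (G : groupType)
  (t : n.-tuple G) (p : pgroup R) : G := eval t (pword p).

Lemma eval_cat n (G : groupType) (t : n.-tuple G) (u v : word n) :
  eval t (u ++ v) = eval t u * eval t v.
Proof. by rewrite /eval big_cat. Qed.

Lemma eval_gen n (G : groupType) (t : n.-tuple G) i : eval t (gen i) = tnth t i.
Proof. by rewrite /eval big_seq1. Qed.

Definition satisfies (n : nat) (G : groupType) (t : n.-tuple G)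
    (R : seq (word n * word n)) : Prop :=
  forall u v, (u, v) \in R -> eval t u = eval t v.

Lemma eval_pres n (R : seq (word n * word n)) (G : groupType) (t : n.-tuple G) :
  satisfies t R -> forall u v, pres_eq R u v -> eval t u = eval t v.
Proof.
move=> tR u v; elim=> {u v} [//|u v _ -> //|u v w _ -> _ -> //|u u' v v' _ e1 _ e2|i b|u v /tR //].
  by rewrite !eval_cat e1 e2.
by rewrite /eval big_cons big_seq1 big_nil; case: b; rewrite /= ?mulVg ?mulgV.
Qed.

Lemma pliftE n (R : seq (word n * word n)) (G : groupType) (t : n.-tuple G) :
  satisfies t R -> forall u, plift t (pclass R u) = eval t u.
Proof. by move=> tR u; apply: eval_pres tR _ _ (pgroup_pword _ _). Qed.

Lemma plift_morph n (R : seq (word n * word n)) (G : groupType) (t : n.-tuple G) :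
  satisfies t R -> monoid_morphism (@plift n R G t).
Proof.
move=> tR; split=> [|p q]; first by rewrite (pliftE tR) /eval big_nil.
by rewrite (pliftE tR) eval_cat.
Qed.

Definition generates (n : nat) (G : groupType) (t : n.-tuple G) : Prop :=
  forall g, exists w, eval t w = g.

(* G = <t_0, ..., t_{n-1} | R> *)
Definition presented_by (n : nat) (G : groupType) (t : n.-tuple G)
    (R : seq (word n * word n)) : Prop :=
  generates t /\ forall u v, eval t u = eval t v <-> pres_eq R u v.

Lemma eval_pgen n (R : seq (word n * word n)) (w : word n) :
  eval [tuple pgen R i | i < n] w = pclass R w.
Proof.
have mulE u v : pclass R u * pclass R v = pclass R (u ++ v).
  by apply/pgroup_eq; apply: pres_cat; apply: pgroup_pword.
elim: w => [|[i b] w IHw]; first by rewrite /eval big_nil.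
rewrite -cat1s eval_cat IHw -mulE; congr (_ * _).
rewrite /eval big_seq1 tnth_mktuple; case: b => //=.
apply/pgroup_eq/(pres_trans (v := winv (gen i))); last exact: pres_refl.
apply/pgroup_eq/(@mulgI _ (pgen R i)); rewrite [LHS]mulgV mulE.
by apply/pgroup_eq/pres_sym; apply: pres_mulwV.
Qed.

Lemma pgroup_presented n (R : seq (word n * word n)) :
  presented_by [tuple pgen R i | i < n] R.
Proof.
split=> [p|u v]; first by exists (pword p); rewrite eval_pgen pwordK.
by rewrite !eval_pgen; split=> [/pgroup_eq|uv]; last apply/pgroup_eq.
Qed.

Definition kernel (G H : groupType) (f : G -> H) : {pred G} :=
  [pred g | f g == 1].

Lemma kernel_group_closed (G H : groupType) (f : UMagmaMorphism.type G H) :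
  group_closed (kernel f).
Proof.
split=> [|x y]; rewrite !inE ?gmulf1 // => /eqP fx /eqP fy.
by rewrite gmulfF fx fy invg1 mulg1.
Qed.

Definition normal_subgroup (G : groupType) (H : {pred G}) : Prop :=
  group_closed H /\ forall h g, h \in H -> h ^ g \in H.

(* x_0 x_1 = x_1 x_0 *)
Definition commuting_rel : seq (word 2 * word 2) :=
  [:: (gen ord0 ++ gen ord_max, gen ord_max ++ gen ord0)].

Definition SG2 : groupType := pgroup commuting_rel.

Definition sigma1 : SG2 := pgen commuting_rel ord0.
Definition tau1 : SG2 := pgen commuting_rel ord_max.

Definition perm_image : 2.-tuple 'S_2 :=
  [tuple tperm ord0 ord_max; tperm ord0 ord_max].

Definition braid_perm : SG2 -> 'S_2 := plift perm_image.

Lemma perm_image_satisfies : satisfies perm_image commuting_rel.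
Proof.
move=> u v; rewrite mem_seq1 => /eqP[-> ->].
by rewrite /eval !big_cons !big_nil !(tnth_nth 1).
Qed.

HB.instance Definition _ := isUMagmaMorphism.Build SG2 'S_2 braid_perm
  (plift_morph perm_image_satisfies).

Lemma braid_perm_sigma1 : braid_perm sigma1 = tperm ord0 ord_max.
Proof.
by rewrite /braid_perm (pliftE perm_image_satisfies) eval_gen (tnth_nth 1).
Qed.

Lemma braid_perm_tau1 : braid_perm tau1 = tperm ord0 ord_max.
Proof.
by rewrite /braid_perm (pliftE perm_image_satisfies) eval_gen (tnth_nth 1).
Qed.

Definition SP2 : Type := {g : SG2 | g \in kernel braid_perm}.

HB.instance Definition _ := SubChoice.on SP2.
HB.instance Definition _ :=
  SubChoice_isSubGroup.Build SG2 _ SP2 (kernel_group_closed braid_perm).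

Lemma a12_subproof : sigma1 ^+ 2 \in kernel braid_perm.
Proof. by rewrite inE gmulfXn /= braid_perm_sigma1 expg2 tperm2. Qed.

Lemma b12_subproof : sigma1 * tau1 \in kernel braid_perm.
Proof. by rewrite inE gmulfM /= braid_perm_sigma1 braid_perm_tau1 tperm2. Qed.

Definition a12 : SP2 := exist _ (sigma1 ^+ 2) a12_subproof.
Definition b12 : SP2 := exist _ (sigma1 * tau1) b12_subproof.

(* Main.v *)
Require Import Defs.
From HB Require Import structures.
From mathcomp Require Import all_boot all_order ssralg ssrint perm.
From mathcomp Require Import ssrnum intdiv zify.

(** In a group presented by two commuting generators, every element is a
    product of powers of the two, and the total exponents of a word in each
    generator do not change under the defining congruence.  Hence the exponent
    sums identify such a group with Z x Z ([presented_commuting]); applied to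
    the standard presentation, this embeds SP_2 into SG_2 = Z x Z, with sigma_1
    and tau_1 as coordinate vectors.

    A word is mapped by pi to the transposition raised to its total exponent,
    so SP_2 lies in the sublattice of the (m, n) with m + n even
    ([SP2_expsum_even]).  There a_12 = (2, 0) and b_12 = (1, 1), and
    (m, n) = (m - n)/2 * (2, 0) + n * (1, 1): these two elements generate SP_2.
    A word with exponent sums (k, l) in a_12, b_12 has coordinates
    (2 k + l, l), which determine (k, l).  As congruence of words modulo the
    commutation relation is equality of exponent sums, no further relation
    holds in SP_2; and then [presented_commuting] applies to SP_2 itself.

    The conjugation formulas say that a_12 and b_12, being products of the
    commuting sigma_1 and tau_1, commute with both. *)

Set Implicit Arguments.
Unset Strict Implicit.
Unset Printing Implicit Defensive.

Local Open Scope group_scope.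

(** * Exponent sums and powers as words *)

Definition expsum (n : nat) (i : 'I_n) (w : word n) : int :=
  (\sum_(l <- w | l.1 == i) (-1) ^+ l.2)%R.

Lemma expsum_nil n (i : 'I_n) : expsum i [::] = 0%R.
Proof. by rewrite /expsum big_nil. Qed.

Lemma expsum_cat n (i : 'I_n) u v :
  expsum i (u ++ v) = (expsum i u + expsum i v)%R.
Proof. by rewrite /expsum big_cat. Qed.

Lemma expsum_cons n (i : 'I_n) l w :
  expsum i (l :: w) = ((if l.1 == i then (-1) ^+ l.2 else 0) + expsum i w)%R.
Proof. by rewrite /expsum big_cons; case: ifP => // _; rewrite GRing.add0r. Qed.

Lemma expsum_pres (i : 'I_2) u v :
  pres_eq commuting_rel u v -> expsum i u = expsum i v.
Proof.
elim=> {u v} [//|u v _ -> //|u v w _ -> _ -> //|u u' v v' _ e1 _ e2|j b|u v].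
- by rewrite !expsum_cat e1 e2.
- by rewrite !expsum_cons expsum_nil /=; case: b; case: (j == i).
rewrite mem_seq1 => /eqP[-> ->].
by rewrite !expsum_cons expsum_nil !GRing.addr0 GRing.addrC.
Qed.

(** The word x_i^m.  Powers with integer exponents are evaluated through these
    words, since the exponents of [^+] are natural numbers. *)
Definition wpow (n : nat) (i : 'I_n) (m : int) : word n :=
  nseq `|m| (i, (m < 0)%R).

Lemma expsum_wpow n (i j : 'I_n) m :
  expsum i (wpow j m) = if j == i then m else 0%R.
Proof.
rewrite /expsum /wpow big_nseq_cond /=; case: (j == i) => //.
rewrite GRing.iter_addr_0; case: m => k /=; first by rewrite GRing.expr0 natz.
by rewrite GRing.expr1 GRing.mulNrn natz NegzE.
Qed.

Lemma eval_cons n (G : groupType) (t : n.-tuple G) l w :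
  eval t (l :: w) = eval t [:: l] * eval t w.
Proof. exact: eval_cat t [:: l] w. Qed.

Lemma eval_cancel n (G : groupType) (t : n.-tuple G) i b w :
  eval t [:: (i, b)] * eval t ((i, ~~ b) :: w) = eval t w.
Proof.
rewrite [eval t (_ :: w)]eval_cons mulgA /eval !big_seq1.
by case: b; rewrite /= ?mulVg ?mulgV mul1g.
Qed.

(** Induction step for normal forms: prepending one letter x_i^(+-1) to a power
    of x_i changes the exponent by +-1, possibly after one cancellation. *)
Lemma eval_wpowS n (G : groupType) (t : n.-tuple G) (i : 'I_n) (b : bool) (m : int) :
  eval t (wpow i ((-1) ^+ b + m)%R) = eval t [:: (i, b)] * eval t (wpow i m).
Proof.
have wposE k : wpow i (Posz k) = nseq k (i, false) by [].
have wnegE k : wpow i (Negz k) = nseq k.+1 (i, true) by [].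
case: b m => [] [[|k]|k].
- by rewrite (_ : (_ + _)%R = Negz 0) // -eval_cons.
- rewrite (_ : (_ + _)%R = Posz k) ?wposE ?(eval_cancel t i true) //=; lia.
- rewrite (_ : (_ + _)%R = Negz k.+1) ?wnegE -?eval_cons //=; lia.
- by rewrite (_ : (_ + _)%R = Posz 1) // -eval_cons.
- rewrite (_ : (_ + _)%R = Posz k.+2) ?wposE -?eval_cons //=; lia.
rewrite (_ : (_ + _)%R = (- Posz k)%R); last by rewrite /=; lia.
by rewrite wnegE (eval_cancel t i false); case: k.
Qed.

(** * Groups presented by two commuting generators *)

Lemma presented_satisfies n (G : groupType) (t : n.-tuple G) R :
  presented_by t R -> satisfies t R.
Proof. by case=> _ tE u v uv; apply/tE/pres_rel. Qed.

Lemma satisfies_commuting (G : groupType) (t : 2.-tuple G) :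
  satisfies t commuting_rel <-> commute (tnth t ord0) (tnth t ord_max).
Proof.
rewrite /commute -!(eval_gen t) -!eval_cat.
split=> [/(_ _ _ (mem_head _ _)) // | c u v].
by rewrite mem_seq1 => /eqP[-> ->].
Qed.

Lemma commute_eval (n : nat) (G : groupType) (t : n.-tuple G) x w :
  (forall l, l \in w -> commute x (tnth t l.1)) -> commute x (eval t w).
Proof.
elim: w => [_|[i b] w IHw c]; first by rewrite /eval big_nil; apply: commute1.
rewrite eval_cons; apply: commuteM; last first.
  by apply: IHw => l lw; apply: c; rewrite in_cons lw orbT.
have ci := c _ (mem_head _ _); rewrite /eval big_seq1 /=.
by case: ifP => // _; apply: commuteV.
Qed.

Lemma ord2P (P : 'I_2 -> Prop) : P ord0 -> P ord_max -> forall i, P i.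
Proof.
move=> P0 P1 [[|[|//]] lt_i]; first by rewrite (_ : Ordinal _ = ord0) //; apply: val_inj.
by rewrite (_ : Ordinal _ = ord_max) //; apply: val_inj.
Qed.

(** Normal form: commutation lets each letter x_1^(+-1) move to the right past
    the power of x_0 and join the power of x_1. *)
Lemma eval_commuting (G : groupType) (t : 2.-tuple G) w :
  satisfies t commuting_rel ->
  eval t w = eval t (wpow ord0 (expsum ord0 w) ++
                     wpow ord_max (expsum ord_max w)).
Proof.
move=> /satisfies_commuting c; elim: w => [|[i b] w IHw].
  by rewrite !expsum_nil.
rewrite eval_cons IHw !expsum_cons /= !eval_cat.
elim/ord2P: i; rewrite /= GRing.add0r eval_wpowS mulgA //.
rewrite mulgA; congr (_ * _); apply/commute_sym/commute_eval => l.
rewrite mem_seq1 => /eqP->; apply/commute_sym/commute_eval => k.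
by rewrite mem_nseq => /andP[_ /eqP->]; apply: commute_sym.
Qed.

(** A homomorphism to an abelian group sees only the exponent sums of a word. *)
Lemma eval_morph n (G : groupType) (V : zmodType) (t : n.-tuple G) (h : G -> V) w :
  {morph h : x y / x * y >-> (x + y)%R} ->
  h (eval t w) = (\sum_i h (tnth t i) *~ expsum i w)%R.
Proof.
move=> hM; have h1 : h 1 = 0%R.
  by apply: (@GRing.addrI _ (h 1)); rewrite -hM mulg1 GRing.addr0.
have hV x : h x^-1 = (- h x)%R.
  by apply: (@GRing.addrI _ (h x)); rewrite -hM mulgV h1 GRing.subrr.
elim: w => [|[i b] w IHw].
  by rewrite /eval big_nil h1 big1 // => i _; rewrite expsum_nil mulr0z.
rewrite eval_cons hM IHw (bigD1 i) //= [in RHS](bigD1 i) //= GRing.addrA.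
congr (_ + _)%R.
  rewrite expsum_cons eqxx mulrzDr; congr (_ + _)%R.
  by rewrite /eval big_seq1 /=; case: b; rewrite ?hV.
apply: eq_bigr => j ji; rewrite expsum_cons /= eq_sym (negPf ji).
by rewrite GRing.add0r.
Qed.

(** The coordinates of g are the exponent sums of any word for g: they are well
    defined since no relation holds beyond commutation, and the normal form
    makes the map injective. *)
Lemma presented_commuting (G : groupType) (t : 2.-tuple G) :
  presented_by t commuting_rel ->
  exists f : G -> int * int,
    [/\ bijective f, {morph f : x y / x * y >-> (x + y)%R}
      & forall w, f (eval t w) = (expsum ord0 w, expsum ord_max w)].
Proof.
move=> tP; have st := presented_satisfies tP; case: tP => tG tE.
have ex g : exists w, eval t w == g by have [w <-] := tG g; exists w.
pose e (w : word 2) := (expsum ord0 w, expsum ord_max w).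
pose f g := e (xchoose (ex g)).
have fE w : f (eval t w) = e w.
  have /eqP/tE uw := xchooseP (ex (eval t w)).
  by rewrite /f /e !(expsum_pres _ uw).
exists f; split=> // [|g h].
  exists (fun m => eval t (wpow ord0 m.1 ++ wpow ord_max m.2)) => [g|[m n]].
    by have [w <-] := tG g; rewrite fE -eval_commuting.
  by rewrite fE /e !expsum_cat !expsum_wpow /= GRing.addr0 GRing.add0r.
have [[u <-] [v <-]] := (tG g, tG h).
by rewrite -eval_cat !fE /e !expsum_cat.
Qed.

(** * The singular pure braid group inside SG_2 *)

Lemma sigma1_tau1 : commute sigma1 tau1.
Proof.
have := presented_satisfies (pgroup_presented commuting_rel).
by move=> /satisfies_commuting; rewrite !tnth_mktuple.
Qed.

Lemma SG2_coord : exists f : SG2 -> int * int,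
  [/\ bijective f, {morph f : x y / x * y >-> (x + y)%R} &
      forall w, f (pclass commuting_rel w) = (expsum ord0 w, expsum ord_max w)].
Proof.
have [f [fb fM fE]] := presented_commuting (pgroup_presented commuting_rel).
by exists f; split=> // w; rewrite -fE eval_pgen.
Qed.

(** The coordinates of SG_2 restricted to SP_2, in two descriptions: the first
    comes from a_12 = (2, 0) and b_12 = (1, 1), the second from words in
    sigma_1 and tau_1. *)
Lemma SP2_coord : exists h : SP2 -> int * int,
  [/\ injective h,
      forall w, h (eval [tuple a12; b12] w)
        = (expsum ord0 w *+ 2 + expsum ord_max w, expsum ord_max w)%R &
      forall g w, val g = pclass commuting_rel w ->
        h g = (expsum ord0 w, expsum ord_max w)].
Proof.
have [f [fb fM fE]] := SG2_coord.
exists (f \o val); split=> [||g w gw]; first exact: inj_comp (bij_inj fb) val_inj.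
  move=> w.
  have f_sigma : f sigma1 = (1, 0)%R by rewrite fE !expsum_cons !expsum_nil.
  have f_tau : f tau1 = (0, 1)%R by rewrite fE !expsum_cons !expsum_nil.
  have ha : f (sigma1 ^+ 2) = (2, 0)%R by rewrite expg2 fM f_sigma.
  have hb : f (sigma1 * tau1) = (1, 1)%R by rewrite fM f_sigma f_tau.
  have h1 : {morph fst \o (f \o (val : SP2 -> SG2)) : x y / x * y >-> (x + y)%R}.
    by move=> x y; rewrite /= fM.
  have h2 : {morph snd \o (f \o (val : SP2 -> SG2)) : x y / x * y >-> (x + y)%R}.
    by move=> x y; rewrite /= fM.
  (* Each component is a homomorphism to the integers, which leaves linear
     arithmetic. *)
  have := eval_morph [tuple a12; b12] w h1; have := eval_morph [tuple a12; b12] w h2.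
  rewrite !big_ord_recl !big_ord0 /= ha hb /=.
  rewrite (_ : lift ord0 ord0 = ord_max); last exact: val_inj.
  case: (f _) => x y /= -> ->; congr (_, _); lia.
by rewrite /= gw fE.
Qed.

(** Both generators and their inverses go to the same transposition, so only
    the parity of the total exponent survives. *)
Lemma eval_perm_image w :
  eval perm_image w =
  if odd (absz (expsum ord0 w + expsum ord_max w)%R) then tperm ord0 ord_max else 1.
Proof.
elim: w => [|[i b] w IHw]; first by rewrite !expsum_nil /eval big_nil.
rewrite eval_cons IHw {1}/eval big_seq1 /=.
have -> : tnth perm_image i = tperm ord0 ord_max.
  by elim/ord2P: i; rewrite (tnth_nth 1).
rewrite tpermV if_same !expsum_cons.
set m := expsum ord0 w; set n := expsum ord_max w.
have -> : odd (absz ((if i == ord0 then (-1) ^+ b else 0) + m +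
                ((if i == ord_max then (-1) ^+ b else 0) + n))%R)
          = ~~ odd (absz (m + n)%R).
  by elim/ord2P: i => /=; case: b; rewrite ?GRing.expr0 ?GRing.expr1; lia.
by case: (odd _) => /=; rewrite ?mulg1 ?tperm2.
Qed.

Lemma SP2_expsum_even (g : SP2) w : val g = pclass commuting_rel w ->
  ~~ odd (absz (expsum ord0 w + expsum ord_max w)%R).
Proof.
move=> gw; have := valP g; rewrite inE gw [braid_perm _](pliftE perm_image_satisfies).
rewrite eval_perm_image; case: odd => // /eqP/permP/(_ ord0).
by rewrite tpermL perm1.
Qed.

Lemma SP2_generated : generates [tuple a12; b12].
Proof.
have [h [h_inj hE hg]] := SP2_coord => g.
have gw : val g = pclass commuting_rel (pword (val g)) by rewrite pwordK.
have := SP2_expsum_even gw; have := hg _ _ gw.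
set m := expsum _ _; set n := expsum _ _ => hgE mn.
(* (m, n) = (m - n)/2 * (2, 0) + n * (1, 1), where m - n is even. *)
exists (wpow ord0 ((m - n) %/ 2)%Z ++ wpow ord_max n); apply: h_inj.
rewrite hE hgE !expsum_cat !expsum_wpow /= GRing.addr0 GRing.add0r.
congr (_, _); lia.
Qed.

Lemma SP2_presented : presented_by [tuple a12; b12] commuting_rel.
Proof.
split=> [|u v]; first exact: SP2_generated.
split=> [uv|]; last first.
  apply/eval_pres/satisfies_commuting/val_inj; rewrite !(tnth_nth a12) /=.
  apply: commuteM; apply/commute_sym/commuteX => //.
  exact/commute_sym/sigma1_tau1.
(* (k, l) |-> (2 k + l, l) is injective, so u and v have the same exponent
   sums and are equal in SG_2, whose presentation has the same relations. *)
have [h [_ hE _]] := SP2_coord.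
have := congr1 h uv; rewrite !hE => -[uv0 uv1].
apply/pgroup_eq; have [f [fb _ fE]] := SG2_coord; apply: (bij_inj fb).
rewrite !fE uv1; congr (_, _); lia.
Qed.

(** * Normality and conjugation *)

Lemma conjg_commute (G : groupType) (x y : G) : commute x y -> x ^ y = x.
Proof. by move=> c; rewrite conjgE c mulKg. Qed.

Lemma kernel_normal (G H : groupType) (f : UMagmaMorphism.type G H) :
  normal_subgroup (kernel f).
Proof.
split=> [|h g]; first exact: kernel_group_closed.
by rewrite !inE => /eqP fh; rewrite gmulfJ fh conj1g.
Qed.

Theorem lemma3p1 :
  [/\ generates [tuple a12; b12],
      presented_by [tuple a12; b12] commuting_rel &
      exists2 f : SP2 -> int * int,
        bijective f & {morph f : x y / x * y >-> (x + y)%R}]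
  /\ (normal_subgroup (kernel braid_perm)
      /\ [/\ val a12 ^ sigma1 = val a12, val b12 ^ sigma1 = val b12,
             val a12 ^ tau1 = val a12 & val b12 ^ tau1 = val b12]).
Proof.
split; [split|split; last split].
- exact: SP2_generated.
- exact: SP2_presented.
- by have [f [fb fM _]] := presented_commuting SP2_presented; exists f.
- exact: kernel_normal.
- by apply/conjg_commute/commute_sym/commuteX.
- apply/conjg_commute/commute_sym/commuteM => //; exact: sigma1_tau1.
- apply/conjg_commute/commute_sym/commuteX/commute_sym; exact: sigma1_tau1.
- apply/conjg_commute/commute_sym/commuteM => //.
  exact/commute_sym/sigma1_tau1.
Qed.
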